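(* Let $m,s\in\mathbb N$, let $q$ be a prime power, let $\mathcal F$ be an $m$-block Ferrers diagram of order $sm$ and let $d\in\{2,\dots,sm\}$. Assume that: (1) $(\mathcal F,d)$ is MSRD-constructible; (2) if $I_B(\mathcal F,d)\ne\emptyset$, then there exists a $[\mathcal T^B_{l,m},\nu_{\min}(\mathcal T^B_{l,m},d),d]_q$ MFD code, where $l:=\max I_B(\mathcal F,d)$. Then there exists an $[\mathcal F,\nu_{\min}(\mathcal F,d),d]_q$ MFD code.
   Context: Notation: $\mathbb N=\{1,2,\dots\}$ and $[n]=\{1,\dots,n\}$, $[0]=\emptyset$. A (top-right justified) Ferrers diagram of order $n$ is a subset $\mathcal F\subseteq[n]^2$ such that (1) $(i,j)\in\mathcal F$ and $j<n$ imply $(i,j+1)\in\mathcal F$; (2) $(i,j)\in\mathcal F$ and $i>1$ imply $(i-1,j)\in\mathcal F$. Write $\mathcal F=[c_1,\dots,c_n]$ where $c_j$ is the number of elements of $\mathcal F$ in column $j$. For $d\in[n]$ and $j\in\{0,\dots,d-1\}$ let $\nu_j(\mathcal F,d)=\sum_{i=1}^{n-j}\max\{0,c_i-d+1+j\}$ and $\nu_{\min}(\mathcal F,d)=\min_{0\le j\le d-1}\nu_j(\mathcal F,d)$. Codes: $\mathbb F_q^{\mathcal F}$ is the space of $n\times n$ matrices over $\mathbb F_q$ whose entries outside the positions in $\mathcal F$ are zero. An $[\mathcal F,k,d]_q$ code is a $k$-dimensional $\mathbb F_q$-linear subspace of $\mathbb F_q^{\mathcal F}$ whose minimum rank over nonzero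 elements is $d$ (the zero code is regarded as an $[\mathcal F,0,d]_q$ code). It is an MFD (maximum Ferrers diagram) code if $k=\nu_{\min}(\mathcal F,d)$. Blocks: $Q_{i,j}=Q_{i,j}^{(m)}:=([im]\setminus[(i-1)m])\times([jm]\setminus[(j-1)m])$. A Ferrers diagram $\mathcal F$ of order $sm$ is an $m$-block Ferrers diagram if $Q_{i,j}\cap\mathcal F\in\{\emptyset,Q_{i,j}\}$ for all $i,j\in[s]$; its block set is $\mathbf B(\mathcal F)=\{Q_{i,j}: i,j\in[s],\ Q_{i,j}\subseteq\mathcal F\}$. Block diagonals: $D_i^B=\{Q_{l,s-i+l}:1\le l\le i\}$, $i\in[s]$. The pair $(\mathcal F,d)$ is MSRD-constructible if $\nu_{\min}(\mathcal F,d)=m\sum_{i=1}^s\max\{m|D_i^B\cap\mathbf B(\mathcal F)|-d+1,0\}$. Set $I_B(\mathcal F,d):=\{i\in[s]:m|D_i^B\cap\mathbf B(\mathcal F)|\ge d\}$. The block triangular diagram of order $lm$ is $\mathcal T_{l,m}^B=\bigcup_{1\le i\le j\le l}Q_{i,j}^{(m)}$. *)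

(* Defs.v *)
From mathcomp Require Import all_boot all_order all_algebra.

Set Implicit Arguments.
Unset Strict Implicit.
Unset Printing Implicit Defensive.

(* Rows, columns and block positions are numbered from 0: the position (i, j)
   of [n]^2 is the pair (i - 1, j - 1) of 'I_n * 'I_n, and the block Q_{i,j}
   is [block m (i - 1) (j - 1)].  Block diagonals D_i^B keep their index
   i in {1, ..., s}, which is their number of blocks.
   The field F_q is an arbitrary finite field K, with q = #|K|. *)

Section Diagrams.
Variable n : nat.
Implicit Types (F : {set 'I_n * 'I_n}) (d j : nat).

Definition ferrers_diagram F : Prop :=
  (forall i j j' : 'I_n, (i, j) \in F -> j' = j.+1 :> nat -> (i, j') \in F) /\
  (forall i i' j : 'I_n, (i, j) \in F -> i = i'.+1 :> nat -> (i', j) \in F).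

Definition col_card F (j : 'I_n) : nat := #|[set i | (i, j) \in F]|.

(* Subtraction truncates at 0, which gives max {0, c_i - d + 1 + j}. *)
Definition nu F d j : nat := \sum_(i < n | i < n - j) (col_card F i + 1 + j - d).

(* The default value [nu F d 0] belongs to the range j < d whenever d > 0. *)
Definition nu_min F d : nat := \big[minn/nu F d 0]_(j < d) nu F d j.

Definition supported_on (K : finFieldType) F (M : 'M[K]_n) : Prop :=
  forall i j : 'I_n, (i, j) \notin F -> M i j = 0%R.

Definition min_rank (K : finFieldType) (C : {vspace 'M[K]_n}) d : Prop :=
  (exists2 M, M \in C & M != 0%R /\ \rank M = d) /\
  (forall M, M \in C -> M != 0%R -> d <= \rank M).

Definition rank_code (K : finFieldType) F k d (C : {vspace 'M[K]_n}) : Prop :=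
  [/\ forall M, M \in C -> supported_on F M,
      \dim C = k
    & C = 0%VS \/ min_rank C d].

Definition mfd_code (K : finFieldType) F d (C : {vspace 'M[K]_n}) : Prop :=
  rank_code F (nu_min F d) d C.

Definition block (m a b : nat) : {set 'I_n * 'I_n} :=
  [set p : 'I_n * 'I_n | (a * m <= p.1 < a.+1 * m) && (b * m <= p.2 < b.+1 * m)].

End Diagrams.

Arguments block {n} m a b.

Section Blocks.
Variables s m : nat.
Implicit Types (F : {set 'I_(s * m) * 'I_(s * m)}) (d i : nat).

Definition block_ferrers_diagram F : Prop :=
  ferrers_diagram F /\
  forall a b : 'I_s, block m a b :&: F = set0 \/ block m a b :&: F = block m a b.

Definition block_set F : {set {set 'I_(s * m) * 'I_(s * m)}} :=
  [set block m ab.1 ab.2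
     | ab : 'I_s * 'I_s & block m ab.1 ab.2 \subset F].

Definition block_diagonal i : {set {set 'I_(s * m) * 'I_(s * m)}} :=
  [set block m a (s - i + a) | a : 'I_i].

Definition msrd_constructible F d : Prop :=
  nu_min F d =
    m * \sum_(1 <= i < s.+1) (m * #|block_diagonal i :&: block_set F| + 1 - d).

Definition index_set F d : {set 'I_s.+1} :=
  [set i : 'I_s.+1 | (0 < i) && (d <= m * #|block_diagonal i :&: block_set F|)].

Definition max_index F d : nat := \max_(i in index_set F d) i.

End Blocks.

Definition block_triangular (l m : nat) : {set 'I_(l * m) * 'I_(l * m)} :=
  \bigcup_(i < l) \bigcup_(j < l | i <= j) block m i j.

(* Main.v *)
Require Import Defs.
From mathcomp Require Import all_boot all_order all_algebra.
From HB Require Import structures.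
From mathcomp Require Import zify.

(** Write e_i for the number of blocks of F on the i-th block diagonal, and let
    l be the largest index with m * e_l >= d.  By constructibility nu_min F d
    is the sum of the m * max(m e_i - d + 1, 0), and only the indices i <= l
    contribute.  If there are none, the zero code does.  Otherwise the block
    diagonals 1, ..., l of order s fill a block triangle of size l in the
    top-right corner, a translate of T = [block_triangular l m].  Take the MFD
    code C of T and keep the words that vanish at the positions of T missing
    from F, translated into the corner: this [shortening] costs at most one
    dimension per missing position, hence at most m^2 (i - e_i) on diagonal i
    ([card_outside_corner]).

    On each diagonal the loss is affordable.  By the Ferrers property a block
    diagonal that is not full holds at least as many blocks as any longer one
    ([block_diagonals_grow]), so for i <= l either e_i = i and nothing is lost,
    or m e_i >= m e_l >= d and
      m (m i - d + 1) - m^2 (i - e_i) = m (m e_i - d + 1),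
    exactly what F needs ([block_count_trade]).  What C has to offer is
    bounded below by [nu_min_triangular]: nu_min T d is at least the sum of the
    m * max(m i - d + 1, 0) over i <= l.  So the shortened code has a subcode
    of dimension nu_min F d, and [embed_code] moves it to order s * m without
    lowering ranks.

    All nonzero ranks are then at least d, and d itself must occur when the
    code is nonzero.  A code with all nonzero ranks above d would satisfy the
    Singleton-type bound for d + 1 ([exists_low_rank]), which is strictly
    smaller than nu_min F d when the latter is positive
    ([mfd_of_min_rank]). *)

Set Implicit Arguments.
Unset Strict Implicit.
Unset Printing Implicit Defensive.

(** * Ranks of matrices with restricted support *)

Section RankSupport.
Local Open Scope ring_scope.
Import GRing.Theory.

(** The matrix factors through the rows indexed by A. *)
Lemma mxrank_rows (K : fieldType) (n p : nat) (A : {set 'I_n}) (M : 'M[K]_(n, p)) :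
  (forall i j, i \notin A -> M i j = 0) -> (\rank M <= #|A|)%N.
Proof.
move=> MA.
pose X : 'M[K]_(n, #|A|) := \matrix_(i, k) (enum_val k == i)%:R.
pose Y : 'M[K]_(#|A|, p) := \matrix_(k, j) M (enum_val k) j.
suff -> : M = X *m Y by exact: mulmx_max_rank.
apply/matrixP=> i j; rewrite mxE.
under eq_bigr => k _ do rewrite !mxE.
rewrite -(big_enum_val (fun x => (x == i)%:R * M x j)) /=.
have [iA | iNA] := boolP (i \in A).
  rewrite (bigD1 i) //= eqxx mul1r big1 ?addr0 // => x /andP[_ /negPf ->].
  by rewrite mul0r.
rewrite MA // big1 // => x xA.
by case: eqP xA iNA => [-> -> | _] //; rewrite mul0r.
Qed.

(** A matrix supported on the rows in A and the columns in B is the sum of its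
    restriction to the rows in A and of a matrix supported on the columns in B. *)
Lemma mxrank_cross (K : fieldType) (n p : nat) (A : {set 'I_n}) (B : {set 'I_p})
    (M : 'M[K]_(n, p)) :
  (forall i j, i \notin A -> j \notin B -> M i j = 0) ->
  (\rank M <= #|A| + #|B|)%N.
Proof.
move=> MAB.
pose M1 : 'M[K]_(n, p) := \matrix_(i, j) if i \in A then M i j else 0.
have -> : M = M1 + (M - M1) by rewrite addrC subrK.
apply: leq_trans (mxrank_add _ _) (leq_add _ _).
  by apply: mxrank_rows => i j /negPf iA; rewrite mxE iA.
rewrite -mxrank_tr; apply: mxrank_rows => j i jB; rewrite !mxE.
by case: ifPn => iA; rewrite ?subrr // subr0 MAB.
Qed.

End RankSupport.

(** * Shortening and subcodes *)

Section Shortening.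
Local Open Scope ring_scope.
Import GRing.Theory.
Variables (K : finFieldType) (n : nat).
Implicit Types (F S : {set 'I_n * 'I_n}) (C : {vspace 'M[K]_n}).

Definition restrict_to S (M : 'M[K]_n) : 'M[K]_n :=
  \matrix_(i, j) if (i, j) \in S then M i j else 0.

Fact restrict_to_is_linear S : linear (restrict_to S).
Proof.
move=> a M N; apply/matrixP=> i j; rewrite !mxE.
by case: ifP => // _; rewrite mulr0 addr0.
Qed.

HB.instance Definition _ S :=
  GRing.isLinear.Build K 'M[K]_n 'M[K]_n _ (restrict_to S) (restrict_to_is_linear S).

(** Such a code lies in the span of the matrix units at the positions of F. *)
Lemma dim_supported F C :
  (forall M, M \in C -> supported_on F M) -> (\dim C <= #|F|)%N.
Proof.
move=> CF.
have sub : (C <= <<[seq delta_mx p.1 p.2 | p <- enum F]>>)%VS.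
  apply/subvP=> M MC; rewrite [M]matrix_sum_delta.
  apply: memv_suml => i _; apply: memv_suml => j _.
  have [ijF | ijNF] := boolP ((i, j) \in F); last first.
    by rewrite (CF M MC) // scale0r mem0v.
  apply/memvZ/memv_span/mapP; exists (i, j) => //.
  by rewrite mem_enum.
apply: leq_trans (dimvS sub) _.
by rewrite cardE -(size_map (fun p => delta_mx p.1 p.2 : 'M[K]_n)) dim_span.
Qed.

(** The words vanishing on S form the kernel, in C, of the restriction to S,
    whose image is supported on F :&: S; rank-nullity bounds the loss. *)
Lemma shortening F S C :
  (forall M, M \in C -> supported_on F M) ->
  exists2 C', (C' <= C)%VS &
    (forall M, M \in C' -> supported_on (F :\: S) M) /\
    (\dim C <= \dim C' + #|F :&: S|)%N.
Proof.
move=> CF; pose r := linfun (restrict_to S).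
exists (C :&: lker r)%VS; first exact: capvSl.
split=> [M | ].
  rewrite memv_cap memv_ker lfunE => /andP[MC /eqP/matrixP Mr] i j.
  rewrite inE negb_and negbK => /orP[ijS | /(CF M MC) //].
  by have := Mr i j; rewrite !mxE ijS.
rewrite -(limg_ker_dim r C) leq_add2l; apply: dim_supported => M.
case/memv_imgP=> N NC -> i j; rewrite lfunE inE negb_and mxE.
case: ifP => [ijS | ijS _] //; rewrite orbF => ijF.
exact: CF.
Qed.

Lemma subvspace_of_dim (vT : vectType K) (V : {vspace vT}) (k : nat) :
  (k <= \dim V)%N -> exists2 U : {vspace vT}, (U <= V)%VS & \dim U = k.
Proof.
move=> kV; pose X := take k (vbasis V).
have fX : free X.
  by have := basis_free (vbasisP V); rewrite -(cat_take_drop k (vbasis V)) => /catl_free.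
exists <<X>>%VS; last by rewrite (eqP fX) size_take_min size_tuple (minn_idPl kV).
by apply/span_subvP => v /mem_take; exact: vbasis_mem.
Qed.

End Shortening.

(** * Embedding a code into a larger order *)

Section Embedding.
Local Open Scope ring_scope.
Import GRing.Theory.

(** With P and Q the 0-1 matrices of f and g, the map is M |-> P M Q.  Its left
    inverse N |-> P^T N Q^T is again made of matrix products, so the rank of M
    is at most that of P M Q. *)
Lemma embed_code (K : finFieldType) (k n d : nat) (f g : 'I_k -> 'I_n)
    (F : {set 'I_n * 'I_n}) (C : {vspace 'M[K]_k}) :
  injective f -> injective g ->
  (forall M, M \in C -> supported_on [set p | (f p.1, g p.2) \in F] M) ->
  (forall M, M \in C -> M != 0 -> (d <= \rank M)%N) ->
  exists C' : {vspace 'M[K]_n},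
    [/\ forall M, M \in C' -> supported_on F M,
        \dim C' = \dim C
      & forall M, M \in C' -> M != 0 -> (d <= \rank M)%N].
Proof.
move=> f_inj g_inj CF Cd.
pose P : 'M[K]_(n, k) := \matrix_(i, a) (i == f a)%:R.
pose Q : 'M[K]_(k, n) := \matrix_(b, j) (j == g b)%:R.
have PK : P^T *m P = 1%:M.
  apply/matrixP=> a a'; rewrite !mxE (bigD1 (f a)) //= !mxE eqxx mul1r.
  rewrite big1 ?addr0 => [|i /negPf ifa]; first by rewrite (inj_eq f_inj).
  by rewrite !mxE ifa mul0r.
have QK : Q *m Q^T = 1%:M.
  apply/matrixP=> b b'; rewrite !mxE (bigD1 (g b)) //= !mxE eqxx mul1r.
  rewrite big1 ?addr0 => [|j /negPf jgb]; first by rewrite (inj_eq g_inj).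
  by rewrite !mxE jgb mul0r.
have embK (M : 'M[K]_k) : P^T *m (P *m M *m Q) *m Q^T = M.
  by rewrite -!mulmxA QK mulmx1 mulmxA PK mul1mx.
pose phi := linfun (mulmxr Q \o mulmx P : 'M[K]_k -> 'M[K]_n).
have phiE M : phi M = P *m M *m Q by rewrite lfunE.
exists (phi @: C)%VS; split.
- move=> _ /memv_imgP[M MC ->] i j ijF; rewrite phiE mxE big1 // => b _.
  rewrite !mxE; case: eqP => [jgb | _]; last by rewrite mulr0.
  rewrite mulr1 big1 // => a _; rewrite mxE; case: eqP => [ifa | _]; last exact: mul0r.
  by rewrite (CF M MC) ?mulr0 // inE -ifa -jgb.
- apply: limg_dim_eq; apply/eqP; rewrite -subv0; apply/subvP=> M.
  rewrite memv_cap memv_ker phiE memv0 => /andP[_ /eqP M0].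
  by rewrite -[M]embK M0 mulmx0 mul0mx.
move=> _ /memv_imgP[M MC ->]; rewrite phiE => N0.
have M0 : M != 0 by apply: contraNneq N0 => ->; rewrite mulmx0 mul0mx.
apply: leq_trans (Cd M MC M0) _.
by rewrite -{1}[M]embK (leq_trans (mxrankM_maxl _ _)) // mxrankM_maxr.
Qed.

End Embedding.

(** * The Singleton-type bound *)

Lemma card_ord_lt (n a : nat) : #|[set i : 'I_n | i < a]| = minn a n.
Proof.
have [an | na] := leqP a n.
  rewrite -sum1_card; under eq_bigl do rewrite inE.
  by rewrite -(big_ord_widen _ (fun=> 1)) // sum1_card card_ord.
rewrite (_ : [set _ | _] = setT) ?cardsT ?card_ord //.
by apply/setP=> i; rewrite !inE (ltn_trans _ na).
Qed.

Section Singleton.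
Variables (K : finFieldType) (n : nat).
Implicit Types (F : {set 'I_n * 'I_n}) (C : {vspace 'M[K]_n}).

Lemma ferrers_col_top F (i i' j : 'I_n) :
  ferrers_diagram F -> (i, j) \in F -> i' <= i -> (i', j) \in F.
Proof.
case=> _ up; elim: {i}(i : nat) {-2}i (erefl (i : nat)) => [|k IH] i ik ijF i'i.
  by have -> : i' = i by apply: ord_inj; lia.
have [/ord_inj -> // | ne] := eqVneq (i' : nat) i.
have kn : k < n by have := ltn_ord i; lia.
by apply: (IH (Ordinal kn)) => //=; [apply: up ijF _ | lia].
Qed.

(** If some entry of column j below the top a rows lies in F, then so do the
    top a entries of that column, so removing them removes exactly a. *)
Lemma card_col_below F (a : nat) (j : 'I_n) :
  ferrers_diagram F -> #|[set i : 'I_n | (a <= i) && ((i, j) \in F)]| <= col_card F j - a.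
Proof.
move=> FF.
set B := [set i | _].
have [-> | /set0Pn[i]] := eqVneq B set0; first by rewrite cards0.
rewrite inE => /andP[ai ijF].
have an : a <= n by apply: ltnW (leq_ltn_trans ai (ltn_ord i)).
rewrite leq_subRL; last first.
  rewrite -(minn_idPl an) -card_ord_lt; apply/subset_leq_card/subsetP=> i'.
  rewrite !inE => i'a; apply: ferrers_col_top ijF _ => //; lia.
rewrite -{1}(minn_idPl an) -card_ord_lt addnC -cardsUI.
rewrite [X in _ + X](_ : _ = 0) ?addn0; last first.
  apply/eqP; rewrite cards_eq0; apply/eqP/setP=> x; rewrite !inE; lia.
apply/subset_leq_card/subsetP=> x; rewrite !inE => /orP[/andP[] // | xa].
by apply: ferrers_col_top ijF _ => //; lia.
Qed.

(** These positions are what remains of F once the top a rows and the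
    rightmost b columns are deleted; with a = d - 1 - j and b = j this is the
    combinatorial meaning of nu F d j. *)
Lemma card_off_cross F (a b : nat) :
  ferrers_diagram F ->
  #|F :&: [set p : 'I_n * 'I_n | (a <= p.1) && (p.2 < n - b)]| <=
    \sum_(j < n | j < n - b) (col_card F j - a).
Proof.
move=> FF; rewrite -sum1_card.
rewrite (eq_bigl (fun p : 'I_n * 'I_n => (p.2 < n - b) && ((a <= p.1) && ((p.1, p.2) \in F)))); last first.
  by case=> i j; rewrite !inE /= andbC [(a <= i) && _]andbC andbA.
rewrite -(pair_big_dep xpredT (fun i j : 'I_n => (j < n - b) && ((a <= i) && ((i, j) \in F))) (fun _ _ => 1)) /=.
rewrite (exchange_big_dep (fun j : 'I_n => j < n - b)) /=; last by move=> i j _ /andP[].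
apply: leq_sum => j jb; apply: leq_trans (card_col_below a j FF).
rewrite sum1_card; apply/eq_leq/eq_card=> i; rewrite !inE.
by rewrite unfold_in /= jb.
Qed.

(** The Singleton-type bound for distance d + 1, in contrapositive form: the
    sum is nu F d.+1 j.  If the dimension exceeds it, some nonzero word
    vanishes off the top d - j rows and the rightmost j columns. *)
Lemma exists_low_rank F C (d j : nat) :
  ferrers_diagram F -> j <= d ->
  (forall M, M \in C -> supported_on F M) ->
  \sum_(i < n | i < n - j) (col_card F i - (d - j)) < \dim C ->
  exists2 M, M \in C & (M != 0)%R /\ \rank M <= d.
Proof.
move=> FF jd CF dimC.
pose S := [set p : 'I_n * 'I_n | (d - j <= p.1) && (p.2 < n - j)].
have [C' C'C [C'F dimC']] := shortening S CF.
have : \dim C' != 0 by have := card_off_cross (d - j) j FF; rewrite -/S; lia.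
rewrite dimv_eq0 => C'0; exists (vpick C').
  exact: (subvP C'C) (memv_pick C').
split; first by rewrite vpick0.
pose A := [set i : 'I_n | i < d - j]; pose B := ~: [set i : 'I_n | i < n - j].
apply: (@leq_trans (#|A| + #|B|)); last first.
  rewrite card_ord_lt [#|B|]cardsCs setCK card_ord card_ord_lt; lia.
apply: mxrank_cross => i k; rewrite !inE negbK -leqNgt => ia kb.
by apply: (C'F _ (memv_pick C')); rewrite !inE /= ia kb.
Qed.

Lemma nu_min_attained F (d : nat) : 0 < d -> exists2 j, j < d & nu_min F d = nu F d j.
Proof.
move=> d0; rewrite /nu_min; apply: (big_ind (fun x => exists2 j, j < d & x = nu F d j)).
- by exists 0.
- move=> _ _ [j jd ->] [j' jd' ->]; rewrite /minn; case: ifP => _; by [exists j | exists j'].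
- by move=> j _; exists j.
Qed.

Lemma leq_nu_min F (d x : nat) :
  0 < d -> (forall j, j < d -> x <= nu F d j) -> x <= nu_min F d.
Proof. by move=> d0 xle; have [j /xle ? ->] := nu_min_attained F d0. Qed.

(** Only the existence of a word of rank exactly d needs an argument.  Let j
    attain the minimum nu_min F d.  If this is positive, so is some term of
    nu F d j, and that term drops when d is replaced by d + 1; then
    [exists_low_rank] yields a nonzero word of rank at most d. *)
Lemma mfd_of_min_rank F C (d : nat) :
  0 < d -> ferrers_diagram F ->
  (forall M, M \in C -> supported_on F M) ->
  \dim C = nu_min F d ->
  (forall M, M \in C -> (M != 0)%R -> d <= \rank M) ->
  mfd_code F d C.
Proof.
move=> d0 FF CF dimC Cd; split=> //.
have [-> | C0] := eqVneq C 0%VS; [by left | right; split=> //].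
rewrite -dimv_eq0 in C0.
have [j jd nuj] := nu_min_attained F d0.
have [|M MC [M0 rM]] := exists_low_rank FF (ltnW jd) CF; last first.
  by exists M => //; split=> //; apply/eqP; rewrite eqn_leq rM Cd.
have : nu F d j != 0 by rewrite -nuj -dimC.
rewrite dimC nuj /nu sum_nat_eq0 negb_forall => /existsP[i].
rewrite negb_imply => /andP[ij ci].
rewrite (bigD1 i) //= [X in _ < X](bigD1 i) //= -addSn.
apply: leq_add; first lia.
by apply: leq_sum => k _; lia.
Qed.

End Singleton.

(** * The block triangle *)

Section Triangle.

(** Hermite's identity.  Passing from x to x + 1 drops the term x %/ m and
    gains (x + m) %/ m, one more. *)
Lemma sum_divn_consecutive (m x : nat) : 0 < m -> \sum_(r < m) (x + r) %/ m = x.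
Proof.
move=> m0; elim: x => [|x IH].
  by rewrite big1 // => r _; rewrite add0n divn_small ?ltn_ord.
rewrite -[in RHS]IH; case: m m0 IH => // m _ _.
rewrite big_ord_recr [in RHS]big_ord_recl /= addn0 addSnnS divnDr // divnn /=.
rewrite addn1 addnS addnC; congr (_ + _).+1.
by apply: eq_bigr => r _; rewrite addSnnS.
Qed.

Lemma sum_truncated_ge (k c : nat) (F : 'I_k -> nat) :
  \sum_(r < k) F r - k * c <= \sum_(r < k) (F r - c).
Proof.
rewrite leq_subLR -[k in k * c]card_ord -sum_nat_const -big_split /=.
by apply: leq_sum => r _; lia.
Qed.

(** The right-hand side is nu_j of the block triangle, whose i-th column has
    height (i %/ m).+1 * m; the left-hand side is its value at j = 0.  The proof
    adds one block column at a time, that is, m consecutive summands aligned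
    with the right end l * m - j instead of with the blocks. *)
Lemma staircase_nu_bound (m d j l : nat) :
  0 < m -> j < d ->
  \sum_(1 <= i < l.+1) m * (m * i + 1 - d) <=
    \sum_(i < l * m - j) ((i %/ m).+1 * m + 1 + j - d).
Proof.
move=> m0 jd; elim: l => [|l IH]; first by rewrite big_geq.
rewrite big_nat_recr //=.
have [jl | lj] := leqP j (l * m).
  (* By Hermite's identity the new heights add up to m (l m - j + m), so the
     new summands, before truncation, add up to m (m (l + 1) + 1 - d). *)
  rewrite (_ : l.+1 * m - j = l * m - j + m); last by lia.
  rewrite big_split_ord /=; apply: leq_add; first exact: IH.
  have [dle | lt] := leqP d (m * l.+1); last by rewrite (_ : _ - d = 0) ?muln0 //; lia.
  apply: leq_trans (leq_trans (sum_truncated_ge (d - 1 - j) (fun r : 'I_m => ((l * m - j + r) %/ m).+1 * m)) _).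
    rewrite -big_distrl /=.
    under eq_bigr do rewrite -addn1.
    rewrite big_split /= sum_divn_consecutive // sum_nat_const card_ord muln1.
    nia.
  apply: leq_sum => r _; lia.
(* Now l * m < j < d: the earlier terms on the left vanish, and at most the
   first (l + 1) m - j columns, all in the first block column, remain. *)
rewrite big_nat big1 ?add0n => [|i /andP[_ il]]; last first.
  have : m * i <= l * m by rewrite mulnC leq_mul2r -ltnS il orbT.
  by move=> ?; rewrite (_ : _ - d = 0) ?muln0 //; lia.
have [|jl] := leqP (l.+1 * m) j.
  by move=> ?; rewrite (_ : _ - d = 0) ?muln0 //; lia.
rewrite (eq_bigr (fun=> m + 1 + j - d)) => [|i _]; last first.
  by rewrite divn_small ?mul1n //; have := ltn_ord i; lia.
rewrite sum_nat_const card_ord; nia.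
Qed.

Lemma mem_block n m a b (p : 'I_n * 'I_n) :
  0 < m -> (p \in block m a b) = (p.1 %/ m == a) && (p.2 %/ m == b).
Proof.
move=> m0; rewrite inE; congr (_ && _).
  by rewrite eqn_leq -(ltnS (_ %/ _)) ltn_divLR // leq_divRL // andbC.
by rewrite eqn_leq -(ltnS (_ %/ _)) ltn_divLR // leq_divRL // andbC.
Qed.

Lemma divn_ord_lt l m (i : 'I_(l * m)) : 0 < m -> i %/ m < l.
Proof. by move=> m0; rewrite ltn_divLR // ltn_ord. Qed.

Lemma mem_triangular l m (p : 'I_(l * m) * 'I_(l * m)) :
  0 < m -> (p \in block_triangular l m) = (p.1 %/ m <= p.2 %/ m).
Proof.
move=> m0; apply/bigcupP/idP.
  case=> a _ /bigcupP[b ab]; rewrite mem_block // => /andP[/eqP -> /eqP ->]; exact: ab.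
move=> le; exists (Ordinal (divn_ord_lt p.1 m0)) => //.
apply/bigcupP; exists (Ordinal (divn_ord_lt p.2 m0)) => //.
by rewrite mem_block // !eqxx.
Qed.

Lemma col_card_triangular l m (j : 'I_(l * m)) :
  0 < m -> (j %/ m).+1 * m <= col_card (block_triangular l m) j.
Proof.
move=> m0; have jl := divn_ord_lt j m0.
have le : (j %/ m).+1 * m <= l * m by rewrite leq_mul2r jl orbT.
rewrite -(minn_idPl le) -card_ord_lt; apply/subset_leq_card/subsetP=> i.
by rewrite !inE mem_triangular //= -ltn_divLR.
Qed.

Lemma nu_min_triangular l m d :
  0 < m -> 0 < d ->
  \sum_(1 <= i < l.+1) m * (m * i + 1 - d) <= nu_min (block_triangular l m) d.
Proof.
move=> m0 d0; apply: leq_nu_min => // j jd.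
apply: leq_trans (staircase_nu_bound l m0 jd) _.
rewrite (big_ord_widen _ (fun i => (i %/ m).+1 * m + 1 + j - d) (leq_subr j (l * m))).
by apply: leq_sum => i _; have := col_card_triangular i m0; lia.
Qed.

End Triangle.

(** If g is true on [0, k], so is h on [0, k) and the minimum is k.  Otherwise g
    fails at some x; then a |-> a for a < x and a |-> a - 1 for a > x inject the
    points of g into those of h.  The induction carries both regimes at once:
    the sum of g exceeds that of h by at most one, and not at all unless h is
    constantly true so far. *)
Lemma sum_overlap (g h : nat -> bool) (k : nat) :
  (forall a, a < k -> g a -> h a) -> (forall a, a < k -> g a.+1 -> h a) ->
  minn k (\sum_(a < k.+1) g a) <= \sum_(a < k) h a.
Proof.
move=> gh gSh.
have sum_gh i : i <= k -> \sum_(a < i) g a <= \sum_(a < i) h a.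
  move=> ik; apply: leq_sum => a _; have := gh a (leq_trans (ltn_ord a) ik).
  by case: (g a) => // ->.
suff H i : i <= k -> \sum_(a < i.+1) g a <= (\sum_(a < i) h a).+1 /\
    (\sum_(a < i) h a < i -> \sum_(a < i.+1) g a <= \sum_(a < i) h a).
  have [_] := H k (leqnn k); lia.
elim: i => [|i IH] ik.
  by rewrite big_ord1 big_ord0; case: (g 0).
rewrite big_ord_recr [\sum_(a < i.+1) h a]big_ord_recr /=.
have := gSh i ik; have := gh i ik; have := sum_gh i (ltnW ik); have [] := IH (ltnW ik).
have : \sum_(a < i.+1) g a = \sum_(a < i) g a + g i by rewrite big_ord_recr.
move: (\sum_(a < i.+1) g a) (\sum_(a < i) g a) (\sum_(a < i) h a) => S G H defS.
case: (h i) => IH1 IH2 le_gh gi gSi; first by case: (g i.+1) => /=; lia.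
have [g0 ->] : g i = false /\ g i.+1 = false by split; apply/negbTE/negP; lia.
by rewrite g0 in defS; lia.
Qed.

(** * Block diagonals of a block Ferrers diagram *)

Section Blocks.
Variables (s m : nat).
Hypothesis m_gt0 : 0 < m.
Implicit Types (F : {set 'I_(s * m) * 'I_(s * m)}).

Lemma coord_proof a r : a < s -> r < m -> a * m + r < s * m.
Proof. by move=> ? ?; nia. Qed.

Definition coord a r (la : a < s) (lr : r < m) : 'I_(s * m) := Ordinal (coord_proof la lr).

Lemma coord_divn a r (la : a < s) (lr : r < m) : coord la lr %/ m = a.
Proof. by rewrite /= divnMDl // divn_small // addn0. Qed.

Lemma block_inj a b a' b' :
  a < s -> b < s -> block m a b = block m a' b' :> {set 'I_(s * m) * 'I_(s * m)} ->
  a = a' /\ b = b'.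
Proof.
move=> la lb /setP/(_ (coord la m_gt0, coord lb m_gt0)).
by rewrite !mem_block // !coord_divn !eqxx => /esym/andP[/eqP -> /eqP ->].
Qed.

(** The blocks are nonempty and pairwise distinct, so counting them as sets
    amounts to counting their indices. *)
Lemma card_block_diagonal F i :
  i <= s ->
  #|block_diagonal s m i :&: block_set F| = \sum_(a < i) (block m a (s - i + a) \subset F).
Proof.
move=> i_s.
have lt (a : 'I_i) : a < s /\ s - i + a < s by have := ltn_ord a; lia.
pose B (a : 'I_i) : {set 'I_(s * m) * 'I_(s * m)} := block m a (s - i + a).
have -> : block_diagonal s m i :&: block_set F = [set B a | a in [set a | B a \subset F]].
  apply/setP=> X; rewrite inE; apply/andP/imsetP.
    case=> /imsetP[a _ ->] /imsetP[ab]; rewrite inE => abF E.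
    by exists a => //; rewrite inE /B E.
  case=> a; rewrite inE => aF ->; split; apply/imsetP; first by exists a.
  by have [la lb] := lt a; exists (Ordinal la, Ordinal lb); rewrite ?inE.
rewrite card_imset; last first.
  by move=> a a' E; have [la lb] := lt a; have [/ord_inj] := block_inj la lb E.
by rewrite -sum1_card big_mkcond; apply: eq_bigr => a _; rewrite inE; case: ifP.
Qed.

Lemma card_block_diagonal_leq F i : #|block_diagonal s m i :&: block_set F| <= i.
Proof.
apply: leq_trans (subset_leq_card (subsetIl _ _)) _.
by apply: leq_trans (leq_imset_card _ _) _; rewrite card_ord.
Qed.

Lemma mem_block_ferrers F (p : 'I_(s * m) * 'I_(s * m)) :
  block_ferrers_diagram F -> (p \in F) = (block m (p.1 %/ m) (p.2 %/ m) \subset F).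
Proof.
case=> _ FB; apply/idP/subsetP => [pF | ]; last by apply; rewrite mem_block // !eqxx.
have := FB (Ordinal (divn_ord_lt p.1 m_gt0)) (Ordinal (divn_ord_lt p.2 m_gt0)).
case=> /= E; last by apply/subsetP/setIidPl.
by have /setP/(_ p) := E; rewrite in_setI pF mem_block // !eqxx inE.
Qed.

(** The top-left position of the block on the right follows a position of the
    given block, and meeting F forces a block to lie in F. *)
Lemma block_right F a b :
  block_ferrers_diagram F -> a < s -> b.+1 < s ->
  block m a b \subset F -> block m a b.+1 \subset F.
Proof.
move=> FB la lb abF; have [[right _] _] := FB.
have lm : m.-1 < m by rewrite prednK.
have := mem_block_ferrers (coord la m_gt0, coord lb m_gt0) FB.
rewrite !coord_divn => <-.
apply: (right _ (coord (ltnW lb) lm)); last by rewrite /= mulSn; lia.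
by rewrite mem_block_ferrers // !coord_divn.
Qed.

Lemma block_up F a b :
  block_ferrers_diagram F -> a.+1 < s -> b < s ->
  block m a.+1 b \subset F -> block m a b \subset F.
Proof.
move=> FB la lb abF; have [[_ up] _] := FB.
have lm : m.-1 < m by rewrite prednK.
have := mem_block_ferrers (coord (ltnW la) lm, coord lb m_gt0) FB.
rewrite !coord_divn => <-.
apply: (up (coord la m_gt0)); last by rewrite /= mulSn; lia.
by rewrite mem_block_ferrers // !coord_divn.
Qed.

(** A block of F on diagonal l + 1 has its right neighbour and its upper
    neighbour on diagonal l, and both lie in F, so [sum_overlap] applies. *)
Lemma block_diagonals_grow F i l :
  block_ferrers_diagram F -> i <= l -> l <= s ->
  minn i #|block_diagonal s m l :&: block_set F| <= #|block_diagonal s m i :&: block_set F|.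
Proof.
move=> FB; elim: l => [|l IH] il ls.
  by rewrite (_ : i = 0) ?min0n //; lia.
have [-> | i_l] := eqVneq i l.+1; first exact: geq_minr.
have step : minn l #|block_diagonal s m l.+1 :&: block_set F| <=
            #|block_diagonal s m l :&: block_set F|.
  rewrite !card_block_diagonal //; last exact: ltnW.
  apply: (@sum_overlap (fun a => block m a (s - l.+1 + a) \subset F)
                       (fun a => block m a (s - l + a) \subset F)) => a al.
    by rewrite (_ : s - l + a = (s - l.+1 + a).+1); [apply: block_right => //; lia | lia].
  by rewrite (_ : s - l.+1 + a.+1 = s - l + a); [apply: block_up => //; lia | lia].
have := IH _ (ltnW ls); lia.
Qed.

End Blocks.

(** * The corner of a diagram that carries the code *)

Lemma card_bigcup_leq (I : Type) (r : seq I) (P : pred I) (T : finType) (A : I -> {set T}) :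
  #|\bigcup_(i <- r | P i) A i| <= \sum_(i <- r | P i) #|A i|.
Proof.
apply: (big_rec2 (fun (B : {set T}) x => #|B| <= x)); first by rewrite cards0.
move=> i x B _ Bx; rewrite -(leq_add2l #|A i|) in Bx; apply: leq_trans Bx.
by rewrite cardsU leq_subr.
Qed.

Lemma card_block_leq n m a b : 0 < m -> #|(block m a b : {set 'I_n * 'I_n})| <= m * m.
Proof.
move=> m0; pose I c := [set i : 'I_n | i %/ m == c].
have card_I c : #|I c| <= m.
  have lt (i : 'I_n) : i %% m < m by rewrite ltn_mod.
  rewrite -[X in _ <= X]card_ord.
  apply: (@leq_card_in _ _ (fun i => Ordinal (lt i))) => i j.
  rewrite !inE => /eqP ic /eqP jc [ij].
  by apply: ord_inj; rewrite (divn_eq i m) (divn_eq j m) ij ic jc.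
rewrite (_ : block m a b = setX (I a) (I b)); first by rewrite cardsX leq_mul.
by apply/setP=> p; rewrite mem_block // !inE.
Qed.

Section Corner.
Variables (s l m : nat) (l_s : l <= s) (F : {set 'I_(s * m) * 'I_(s * m)}).

Lemma left_proof (i : 'I_(l * m)) : i < s * m.
Proof. by apply: leq_trans (ltn_ord i) _; rewrite leq_mul2r l_s orbT. Qed.

Lemma right_proof (j : 'I_(l * m)) : j + (s - l) * m < s * m.
Proof.
rewrite mulnBl; have := ltn_ord j; have := leq_mul l_s (leqnn m); lia.
Qed.

Definition corner_row (i : 'I_(l * m)) : 'I_(s * m) := Ordinal (left_proof i).
Definition corner_col (j : 'I_(l * m)) : 'I_(s * m) := Ordinal (right_proof j).

(** The part of F in the first l * m rows and the last l * m columns, as a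
    diagram of order l * m.  Block diagonal i of order l becomes block
    diagonal i of order s. *)
Definition corner : {set 'I_(l * m) * 'I_(l * m)} :=
  [set p | (corner_row p.1, corner_col p.2) \in F].

Lemma corner_row_inj : injective corner_row.
Proof. by move=> i j [/ord_inj]. Qed.

Lemma corner_col_inj : injective corner_col.
Proof. by move=> i j [/addIn/ord_inj]. Qed.

Hypotheses (m_gt0 : 0 < m) (FB : block_ferrers_diagram F).

Lemma mem_corner p :
  (p \in corner) = (block m (p.1 %/ m) (s - l + p.2 %/ m) \subset F).
Proof. by rewrite inE mem_block_ferrers //= addnC divnMDl. Qed.

(** A missing position lies in a block (a, l - i + a) of the triangle, on some
    diagonal i, whose translate is one of the i - e_i blocks absent from F; each
    accounts for at most m * m positions. *)
Lemma card_outside_corner :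
  #|block_triangular l m :&: ~: corner| <=
    \sum_(1 <= i < l.+1) m * m * (i - #|block_diagonal s m i :&: block_set F|).
Proof.
pose A i : {set 'I_(l * m) * 'I_(l * m)} :=
  \bigcup_(a < i | ~~ (block m a (s - i + a) \subset F)) block m a (l - i + a).
apply: (@leq_trans #|\bigcup_(1 <= i < l.+1) A i|).
  apply/subset_leq_card/subsetP=> p.
  have shift c x y : x <= y -> y < l -> l <= c -> c - (l - (y - x)) + x = c - l + y by lia.
  rewrite inE mem_triangular // inE mem_corner => /andP[le pNF].
  have lt := divn_ord_lt p.2 m_gt0.
  pose i := l - (p.2 %/ m - p.1 %/ m).
  have ai : p.1 %/ m < i by rewrite /i; lia.
  have i_in : i \in index_iota 1 l.+1.
    by rewrite mem_index_iota ltnS leq_subr (leq_ltn_trans _ ai).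
  rewrite (bigD1_seq i) ?iota_uniq //=.
  apply/setUP; left; apply/bigcupP; exists (Ordinal ai) => /=.
    by rewrite shift.
  by rewrite mem_block // eqxx shift // subnn /=.
apply: leq_trans (card_bigcup_leq _ _ _) _.
rewrite big_nat [leqRHS]big_nat; apply: leq_sum => i /andP[i0 il].
apply: leq_trans (card_bigcup_leq _ _ _) _.
apply: (@leq_trans (\sum_(a < i | ~~ (block m a (s - i + a) \subset F)) m * m)).
  by apply: leq_sum => a _; apply: card_block_leq.
rewrite sum_nat_const mulnC leq_mul2l; apply/orP; right.
rewrite leq_subRL ?card_block_diagonal_leq // card_block_diagonal //; last by lia.
rewrite -sum1_card [X in _ + X]big_mkcond /= -big_split /=.
rewrite -[leqRHS]card_ord -sum1_card.
by apply: leq_sum => a _; rewrite unfold_in; case: (block _ _ _ \subset F).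
Qed.

End Corner.

(** * The shortening budget and the code *)

Section MaxIndex.
Variables (s m d : nat) (F : {set 'I_(s * m) * 'I_(s * m)}).
Let e i := #|block_diagonal s m i :&: block_set F|.

Lemma max_indexP :
  index_set F d != set0 ->
  max_index F d <= s /\ d <= m * e (max_index F d).
Proof.
case/set0Pn=> i0 i0_in; rewrite /max_index (bigmax_eq_arg i0) //.
by case: arg_maxnP => // i; rewrite inE => /andP[_ ?] _; rewrite -ltnS ltn_ord.
Qed.

Lemma above_max_index i : max_index F d < i <= s -> m * e i < d.
Proof.
case/andP=> li i_s; rewrite ltnNge; apply/negP=> de.
have i_lt : i < s.+1 by [].
have : Ordinal i_lt \in index_set F d by rewrite inE /= (leq_ltn_trans _ li).
by move/(@leq_bigmax_cond _ _ (fun i : 'I_s.+1 => i : nat)); rewrite /= leqNgt => /negP[].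
Qed.

End MaxIndex.

(** Without truncation both sides agree; the hypotheses ensure that truncation
    only matters when no block is missing. *)
Lemma block_count_trade (m d i e : nat) :
  e <= i -> e = i \/ d <= m * e ->
  m * (m * e + 1 - d) + m * m * (i - e) <= m * (m * i + 1 - d).
Proof.
move=> ei [-> | de]; first by rewrite subnn muln0 addn0.
rewrite -mulnA -mulnDr leq_mul2l; apply/orP; right.
by have := subnKC ei; move: (i - e) => c <-; rewrite mulnDr; lia.
Qed.

Unset Implicit Arguments.

Theorem theorem5p3 (m s : nat) (K : finFieldType)
  (F : {set 'I_(s * m) * 'I_(s * m)}) (d : nat)
  (m_gt0 : 0 < m) (s_gt0 : 0 < s)
  (F_block : block_ferrers_diagram F)
  (d_range : 2 <= d <= s * m)
  (F_constructible : msrd_constructible F d)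
  (triangular_code : index_set F d != set0 ->
     let l := max_index F d in
     exists C : {vspace 'M[K]_(l * m)}, mfd_code (block_triangular l m) d C) :
  exists C : {vspace 'M[K]_(s * m)}, mfd_code F d C.
Proof.
have d_gt0 : 0 < d by lia.
have FF := F_block.1.
set l := max_index F d in triangular_code.
pose e i := #|block_diagonal s m i :&: block_set F|.
have l_s : l <= s by apply/bigmax_leqP => i _; rewrite -ltnS.
have nuF : nu_min F d = \sum_(1 <= i < l.+1) m * (m * e i + 1 - d).
  rewrite F_constructible big_distrr (@big_cat_nat _ _ _ l.+1) //= [X in _ + X]big_nat.
  rewrite [X in _ + X]big1 ?addn0 // => i /above_max_index H.
  by rewrite (_ : _ - d = 0) ?muln0 //; apply/eqP; rewrite subn_eq0 addn1.
have [I0 | I_n0] := eqVneq (index_set F d) set0.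
  have l0 : l = 0 by rewrite /l /max_index I0 big_set0.
  exists 0%VS; apply: mfd_of_min_rank => //.
  - by move=> M; rewrite memv0 => /eqP -> i j _; rewrite mxE.
  - by rewrite dimv0 nuF l0 big_geq.
  - by move=> M; rewrite memv0 => ->.
have [C [CT dimC Cd]] := triangular_code I_n0.
have {}Cd M : M \in C -> (M != 0)%R -> d <= \rank M.
  case: Cd => [-> | [_]]; last exact.
  by rewrite memv0 => ->.
have [C1 C1C [C1F dimC1]] := shortening (~: corner l_s F) CT.
have e_l : d <= m * e l by case: (max_indexP I_n0).
have trade : nu_min F d <= \dim C1.
  suff : nu_min F d + \sum_(1 <= i < l.+1) m * m * (i - e i) <= \dim C.
    move=> budget; rewrite -(leq_add2r (\sum_(1 <= i < l.+1) m * m * (i - e i))).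
    apply: leq_trans budget (leq_trans dimC1 _); rewrite leq_add2l.
    exact: card_outside_corner.
  rewrite dimC; apply: leq_trans (nu_min_triangular l m_gt0 d_gt0).
  rewrite nuF -big_split /= big_nat [leqRHS]big_nat; apply: leq_sum => i /andP[i0 il].
  apply: block_count_trade; first exact: card_block_diagonal_leq.
  have := block_diagonals_grow m_gt0 F_block (il : i <= l) l_s; rewrite -/(e i) -/(e l).
  have [-> | ne] := eqVneq (e i) i; [by left | right].
  apply: leq_trans e_l _; rewrite leq_mul2l; apply/orP; right.
  by have := card_block_diagonal_leq F i; rewrite -/(e i); lia.
have [C2 C2C1 dimC2] := subvspace_of_dim trade.
have C2C : (C2 <= C)%VS := subv_trans C2C1 C1C.
have [||C' [C'F dimC' C'd]] :=
  embed_code (d := d) (F := F) (C := C2)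
    (@corner_row_inj s l m l_s) (@corner_col_inj s l m l_s).
- move=> M /(subvP C2C1)/C1F MF p q pq; apply: MF.
  by rewrite !inE negbK in pq *; rewrite (negPf pq).
- by move=> M /(subvP C2C); apply: Cd.
by exists C'; apply: mfd_of_min_rank; rewrite // dimC'.
Qed.
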